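(* Consider the nominal hybrid system $\mathcal H_0$, the closed-loop hybrid system $\mathcal H$, and the sets $\mathcal A_s$ and $\mathcal A$ defined in the context. Suppose that: (i) the nonempty compact set $\mathcal A_0\subset\mathbb R^{n_x+n_c}$ is globally asymptotically stable for $\mathcal H_0$; (ii) $\mathcal H$ satisfies the hybrid basic conditions and the viability conditions; (iii) there exist $\mu>0$ and $\ell>\sup_{\xi\in\mathcal A+\mu\mathbb B}|\xi|$ such that $\mathcal A_s$ is finite-time attractive for $\mathcal H$ from $(\mathcal A_s+\mu\mathbb B)\cap\ell\mathbb B$ with a settling-time function $T:\Xi\to[0,+\infty)$ satisfying $\sup T((\mathcal A_s+\mu\mathbb B)\cap\ell\mathbb B)<+\infty$, and $\mathcal A_s$ is strongly forward pre-invariant for $\mathcal H$; (iv) the solutions to $\mathcal H$ possess a uniform semiglobal persistent flow time from $\mathcal A_s$. Then each $\phi\in\mathcal S_{\mathcal H}(\mathcal A+\mu\mathbb B)$ is not Zeno.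
   Context: Notation. $|\cdot|$ is the Euclidean norm; for nonempty $\mathcal X\subset\mathbb R^n$, $|v|_{\mathcal X}=\inf_{w\in\mathcal X}|w-v|$ and $\mathcal X+\mu\mathbb B=\{v:|v|_{\mathcal X}\le\mu\}$; $\ell\mathbb B=\{v:|v|\le\ell\}$. For a set-valued map $\mathcal F$, $\operatorname{dom}\mathcal F=\{x:\mathcal F(x)\ne\emptyset\}$. $\mathcal T_{\mathcal X}(x)$ is the tangent (contingent) cone to $\mathcal X$ at $x$. Hybrid systems. $\mathcal H=(\mathcal C,\mathcal F,\mathcal D,\mathcal G)$ denotes $\dot\xi\in\mathcal F(\xi)$ for $\xi\in\mathcal C$; $\xi^+\in\mathcal G(\xi)$ for $\xi\in\mathcal D$. A hybrid time domain is a set $E\subset[0,\infty)\times\mathbb N$ such that for each $(T',J)\in E$, $E\cap([0,T']\times\{0,\dots,J\})$ is a finite union of sets $[t_j,t_{j+1}]\times\{j\}$ with $0=t_0\le t_1\le\cdots$. A solution is a function $\phi$ on a hybrid time domain $\operatorname{dom}\phi$, locally absolutely continuous in $t$ for each fixed $j$, with $\phi(0,0)\in\overline{\mathcal C}\cup\mathcal D$, such that for each $j$ for which $I^j=\{t:(t,j)\in\operatorname{dom}\phi\}$ has nonempty interior, $\phi(t,j)\in\mathcal C$ on $\operatorname{int}I^j$ and $\frac{d}{dt}\phi(t,j)\in\mathcal F(\phi(t,j))$ for almost all $t\in I^j$; and whenever $(t,j),(t,j+1)\in\operatorname{dom}\phi$, $\phi(t,j)\in\mathcal D$ and $\phi(t,j+1)\in\mathcal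 G(\phi(t,j))$. A solution is maximal if it cannot be extended, complete if its domain is unbounded, Zeno if it is complete and $\sup\{t:(t,j)\in\operatorname{dom}\phi\}<\infty$. $\mathcal S_{\mathcal H}(\mathcal X)$ is the set of maximal solutions with $\phi(0,0)\in\mathcal X$. Stability notions for a nonempty set $\mathcal A$ and hybrid system $\mathcal H$. Stable: for each $\varepsilon>0$ there is $\delta>0$ such that each solution with $|\phi(0,0)|_{\mathcal A}\le\delta$ has $|\phi(t,j)|_{\mathcal A}\le\varepsilon$ on $\operatorname{dom}\phi$. Globally attractive: for every $\mu>0$, each $\phi\in\mathcal S_{\mathcal H}(\mathcal A+\mu\mathbb B)$ is complete and $\lim_{t+j\to\infty}|\phi(t,j)|_{\mathcal A}=0$. Globally asymptotically stable: stable and globally attractive. Finite-time attractive from $\mathcal X$ with settling-time function $T$: each $\phi\in\mathcal S_{\mathcal H}(\mathcal X)$ satisfies $\sup\{t+j:(t,j)\in\operatorname{dom}\phi\}\ge T(\phi(0,0))$ and $\lim_{(t,j)\in\operatorname{dom}\phi:\,t+j\nearrow T(\phi(0,0))}|\phi(t,j)|_{\mathcal A}=0$; the limit condition is understood to mean that the set has been reached by hybrid time $T(\phi(0,0))$, which for a closed strongly forward pre-invariant set means $\phi(t,j)\in\mathcal A$ for every $(t,j)\in\operatorname{dom}\phi$ with $t+j\ge T(\phi(0,0))$. Strongly forward pre-invariant: each $\phi\in\mathcal S_{\mathcal H}(\mathcal A)$ has range contained in $\mathcal A$. The solutions to $\mathcal H$ possess a uniform semiglobal persistent flow time from $\mathcal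 X$ if for each $r\ge0$ there exist $\tau>0$, $N\in\mathbb N$ such that each solution $\psi$ with $\psi(0,0)\in\mathcal X\cap r\mathbb B$ satisfies $j\le t/\tau+N$ for each $(t,j)\in\operatorname{dom}\psi$. Setting. Let $f:\mathbb R^{n_x}\times\mathbb R^{n_u}\to\mathbb R^{n_x}$ (plant $\dot x=f(x,u)$), $h:\mathbb R^{n_x}\to\mathbb R^{n_y}$ (output), $\kappa:\mathbb R^{n_c}\times\mathbb R^{n_x}\to\mathbb R^{n_u}$ (feedback); a hybrid controller with data $\mathcal C_c,\mathcal D_c\subset\mathbb R^{n_c}\times\mathbb R^{n_x}$ and set-valued maps $\mathcal F_c,\mathcal G_c:\mathbb R^{n_c}\times\mathbb R^{n_x}\rightrightarrows\mathbb R^{n_c}$, with $\operatorname{dom}\mathcal G_c=\mathcal D_c$; an observer with flow set $\mathcal C_o\subset\mathbb R^{n_o}\times\mathbb R^{n_y}\times\mathbb R^{n_u}$, flow map $\mathcal F_o$ (values in subsets of $\mathbb R^{n_o}$) and output map $h_o:\mathbb R^{n_o}\times\mathbb R^{n_y}\to\mathbb R^{n_{\hat x}}$; a synthetic model with flow set $\mathcal C_s\subset\mathbb R^{n_x}\times\mathbb R^{n_u}\times\mathbb R^{n_{\hat x}}$. Nominal system $\mathcal H_0=(\mathcal C_0,\mathcal F_0,\mathcal D_0,\mathcal G_0)$ with state $(x,x_c)$: $\mathcal C_0=\{(x,x_c):(x_c,x)\in\mathcal C_c\}$, $\mathcal D_0=\{(x,x_c):(x_c,x)\in\mathcal D_c\}$,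 $\mathcal F_0(x,x_c)=\{f(x,\kappa(x_c,x))\}\times\mathcal F_c(x_c,x)$, $\mathcal G_0(x,x_c)=\{x\}\times\mathcal G_c(x_c,x)$. Closed loop $\mathcal H=(\mathcal C,\mathcal F,\mathcal D,\mathcal G)$ with state $\xi=(x,x_c,x_s,x_o)\in\Xi=\mathbb R^{n_x}\times\mathbb R^{n_c}\times\mathbb R^{n_x}\times\mathbb R^{n_o}$: $\mathcal F(\xi)=\{f(x,\kappa(x_c,x_s))\}\times\mathcal F_c(x_c,x_s)\times\{f(x_s,\kappa(x_c,x_s))\}\times\mathcal F_o(x_o,h(x),\kappa(x_c,x_s))$; $\mathcal C=\{\xi:(x_c,x_s)\in\mathcal C_c,\ (x_s,\kappa(x_c,x_s),h_o(x_o,h(x)))\in\mathcal C_s,\ (x_o,h(x),\kappa(x_c,x_s))\in\mathcal C_o\}$; $\mathcal D=\{\xi:(x_c,x_s)\in\mathcal D_c\text{ or }\xi\in\mathcal D_{so}\}$; $\mathcal G(\xi)=\tilde{\mathcal G}_c(\xi)\cup\tilde{\mathcal G}_{so}(\xi)$ with $\tilde{\mathcal G}_c(\xi)=\{x\}\times\mathcal G_c(x_c,x_s)\times\{x_s\}\times\{x_o\}$ and $\tilde{\mathcal G}_{so}(\xi)=\{x\}\times\{x_c\}\times\mathcal G_{so}(\xi)$, where $\mathcal D_{so}\subset\Xi$ and $\mathcal G_{so}:\Xi\rightrightarrows\mathbb R^{n_x+n_o}$ are given with $\operatorname{dom}\mathcal G_{so}=\mathcal D_{so}$. Sets. $\Pi:\mathbb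 R^{n_x}\rightrightarrows\mathbb R^{n_o}$ is outer semicontinuous, locally bounded, nonempty- and closed-valued, and Lipschitz continuous: for some $L\ge0$, $\sup_{y\in\mathbb R^{n_o}}\big||y|_{\Pi(x_1)}-|y|_{\Pi(x_2)}\big|\le L|x_1-x_2|$ for all $x_1,x_2$. $\mathcal A_s=\{\xi\in\Xi:x=x_s,\ x_o\in\Pi(x)\}$. Given a nonempty compact $\mathcal A_0\subset\mathbb R^{n_x+n_c}$, $\mathcal A=\{\xi\in\Xi:(x,x_c)\in\mathcal A_0,\ \xi\in\mathcal A_s\}$. Hybrid basic conditions for $\mathcal H$: $\mathcal C,\mathcal D$ closed; $\mathcal F$ outer semicontinuous and locally bounded relative to $\mathcal C\subset\operatorname{dom}\mathcal F$ and convex-valued on $\mathcal C$; $\mathcal G$ outer semicontinuous and locally bounded relative to $\mathcal D\subset\operatorname{dom}\mathcal G$. Viability conditions for $\mathcal H$: each $\xi_0\in\mathcal C\setminus\mathcal D$ has a neighborhood $\mathcal U$ with $\mathcal F(\xi)\cap\mathcal T_{\mathcal C}(\xi)\ne\emptyset$ for each $\xi\in\mathcal C\cap\mathcal U$; either $\mathcal C$ is compact, or $\mathcal F$ has linear growth on $\mathcal C$, or $\mathcal F$ is single-valued and locally Lipschitz on $\mathcal C$; and $\mathcal G(\mathcal D)\subset\mathcal C\cup\mathcal D$. *)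

(* Defs.v *)
From mathcomp Require Export all_boot all_order all_algebra.
From mathcomp Require Export all_classical all_reals all_analysis.
Export Order.TTheory GRing.Theory Num.Theory.
Export numFieldNormedType.Exports.

Set Implicit Arguments.
Unset Strict Implicit.
Unset Printing Implicit Defensive.

Local Open Scope classical_set_scope.
Local Open Scope ring_scope.

(* The library norm on ['rV[R]_n] is the sup norm, so the Euclidean norm is
   defined here; topological notions (closed, compact, closure, nbhs, limits,
   derivatives) do not depend on the choice and are the library's. *)
Definition enorm {R : realType} {n : nat} (v : 'rV[R]_n) : R :=
  Num.sqrt (\sum_(i < n) v 0 i ^+ 2).

Definition eball {R : realType} {n : nat} (l : R) : set 'rV[R]_n :=
  [set v | enorm v <= l].

Definition edist {R : realType} {n : nat} (v : 'rV[R]_n) (X : set 'rV[R]_n) : R :=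
  inf [set enorm (w - v) | w in X].

(* X + mu B *)
Definition enlarge {R : realType} {n : nat} (X : set 'rV[R]_n) (mu : R) :
    set 'rV[R]_n :=
  [set v | edist v X <= mu].

Definition svdom {S V : Type} (F : S -> set V) : set S := [set x | F x !=set0].

(* Outer semicontinuity and local boundedness relative to a set [S]; the
   absolute notions are obtained with [S := setT]. *)
Definition outer_semicontinuous_on {R : realType} {m n : nat}
    (F : 'rV[R]_m -> set 'rV[R]_n) (S : set 'rV[R]_m) : Prop :=
  forall (x_ : nat -> 'rV[R]_m) (y_ : nat -> 'rV[R]_n) (x : 'rV[R]_m) (y : 'rV[R]_n),
    S x -> (forall i, S (x_ i)) -> (forall i, F (x_ i) (y_ i)) ->
    x_ @ \oo --> x -> y_ @ \oo --> y -> F x y.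

Definition locally_bounded_on {R : realType} {m n : nat}
    (F : 'rV[R]_m -> set 'rV[R]_n) (S : set 'rV[R]_m) : Prop :=
  forall x, S x -> exists2 U, nbhs x U &
    exists r : R, forall x', U x' -> S x' -> F x' `<=` eball r.

(* Contingent (Bouligand) cone. *)
Definition tangent_cone {R : realType} {n : nat} (X : set 'rV[R]_n)
    (x : 'rV[R]_n) : set 'rV[R]_n :=
  [set w | exists (x_ : nat -> 'rV[R]_n) (tau_ : nat -> R),
     [/\ forall i, X (x_ i), forall i, 0 < tau_ i,
         x_ @ \oo --> x, tau_ @ \oo --> (0 : R) &
         (fun i => (tau_ i)^-1 *: (x_ i - x)) @ \oo --> w]].

Definition linear_growth_on {R : realType} {m n : nat}
    (F : 'rV[R]_m -> set 'rV[R]_n) (S : set 'rV[R]_m) : Prop :=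
  exists2 k : R, 0 <= k &
    forall x v, S x -> F x v -> enorm v <= k * (1 + enorm x).

Definition single_valued_locally_lipschitz_on {R : realType} {m n : nat}
    (F : 'rV[R]_m -> set 'rV[R]_n) (S : set 'rV[R]_m) : Prop :=
  exists g : 'rV[R]_m -> 'rV[R]_n,
    (forall x, S x -> F x = [set g x]) /\
    (forall x, S x -> exists2 U, nbhs x U & exists2 k : R, 0 <= k &
       forall x1 x2, (U `&` S) x1 -> (U `&` S) x2 ->
         enorm (g x1 - g x2) <= k * enorm (x1 - x2)).

Definition absolutely_continuous_on {R : realType} {n : nat} (a b : R)
    (g : R -> 'rV[R]_n) : Prop :=
  forall eps : R, 0 < eps -> exists2 delta : R, 0 < delta &
    forall (N : nat) (l u : 'I_N -> R),
      (forall k, a <= l k /\ l k <= u k /\ u k <= b) ->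
      trivIset setT (fun k => `]l k, u k[%classic) ->
      \sum_(k < N) (u k - l k) < delta ->
      \sum_(k < N) enorm (g (u k) - g (l k)) < eps.

Definition locally_absolutely_continuous_on {R : realType} {n : nat} (I : set R)
    (g : R -> 'rV[R]_n) : Prop :=
  forall a b : R, a <= b -> `[a, b]%classic `<=` I ->
    absolutely_continuous_on a b g.

Definition hybrid_time_domain {R : realType} (E : set (R * nat)) : Prop :=
  (forall t j, E (t, j) -> 0 <= t) /\
  (forall T' J, E (T', J) ->
     exists (K : nat) (t_ : nat -> R),
       [/\ t_ 0%N = 0, forall j, t_ j <= t_ j.+1 &
           E `&` [set p | 0 <= p.1 <= T' /\ (p.2 <= J)%N] =
           [set p | (p.2 < K)%N /\ t_ p.2 <= p.1 <= t_ p.2.+1]]).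

(* The values of [arc_val] outside [arc_dom] are irrelevant. *)
Record hybrid_arc (R : realType) (n : nat) := HybridArc {
  arc_dom : set (R * nat);
  arc_val :> R -> nat -> 'rV[R]_n }.

Record hybrid_system (R : realType) (n : nat) := HybridSystem {
  flow_set : set 'rV[R]_n;
  flow_map : 'rV[R]_n -> set 'rV[R]_n;
  jump_set : set 'rV[R]_n;
  jump_map : 'rV[R]_n -> set 'rV[R]_n }.

Definition flow_times {R : realType} {n : nat} (phi : hybrid_arc R n) (j : nat) :
    set R :=
  [set t | arc_dom phi (t, j)].

(* The two-sided derivative is taken of a total function; at the (at most two)
   end points of [flow_times phi j] it is meaningless, which "almost all"
   absorbs. *)
Definition is_solution {R : realType} {n : nat} (H : hybrid_system R n)
    (phi : hybrid_arc R n) : Prop :=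
  [/\ hybrid_time_domain (arc_dom phi),
      arc_dom phi (0, 0%N) /\
      (closure (flow_set H) `|` jump_set H) (phi 0 0%N),
      forall j, locally_absolutely_continuous_on (flow_times phi j) (phi ^~ j),
      forall j, (flow_times phi j)° !=set0 ->
        (forall t, (flow_times phi j)° t -> flow_set H (phi t j)) /\
        {ae lebesgue_measure, forall t : R, flow_times phi j t ->
           exists2 v, is_derive t 1 (phi ^~ j) v & flow_map H (phi t j) v} &
      forall t j, arc_dom phi (t, j) -> arc_dom phi (t, j.+1) ->
        jump_set H (phi t j) /\ jump_map H (phi t j) (phi t j.+1)].

Definition is_maximal {R : realType} {n : nat} (H : hybrid_system R n)
    (phi : hybrid_arc R n) : Prop :=
  is_solution H phi /\
  forall psi, is_solution H psi -> arc_dom phi `<=` arc_dom psi ->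
    (forall t j, arc_dom phi (t, j) -> psi t j = phi t j) ->
    arc_dom psi = arc_dom phi.

Definition is_complete {R : realType} {n : nat} (phi : hybrid_arc R n) : Prop :=
  forall M : R, exists t j, arc_dom phi (t, j) /\ M < t + j%:R.

Definition is_zeno {R : realType} {n : nat} (phi : hybrid_arc R n) : Prop :=
  is_complete phi /\
  (ereal_sup [set p.1%:E | p in arc_dom phi] < +oo)%E.

Definition max_solutions {R : realType} {n : nat} (H : hybrid_system R n)
    (X : set 'rV[R]_n) : set (hybrid_arc R n) :=
  [set phi | is_maximal H phi /\ X (phi 0 0%N)].

Definition stable {R : realType} {n : nat} (A : set 'rV[R]_n)
    (H : hybrid_system R n) : Prop :=
  forall eps : R, 0 < eps -> exists2 delta : R, 0 < delta &
    forall phi, is_solution H phi -> edist (phi 0 0%N) A <= delta ->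
      forall t j, arc_dom phi (t, j) -> edist (phi t j) A <= eps.

Definition globally_attractive {R : realType} {n : nat} (A : set 'rV[R]_n)
    (H : hybrid_system R n) : Prop :=
  forall mu : R, 0 < mu -> forall phi, max_solutions H (enlarge A mu) phi ->
    is_complete phi /\
    (forall eps : R, 0 < eps -> exists M : R, forall t j,
       arc_dom phi (t, j) -> M <= t + j%:R -> edist (phi t j) A < eps).

Definition globally_asymptotically_stable {R : realType} {n : nat}
    (A : set 'rV[R]_n) (H : hybrid_system R n) : Prop :=
  stable A H /\ globally_attractive A H.

(* The condition that [edist (phi t j) A] tends to 0 as [t + j] increases to the
   settling time [T (phi 0 0)] expresses that A has been reached by that hybrid
   time. It is rendered in the form this takes for A closed and strongly forward
   pre-invariant: phi is in A from hybrid time [T (phi 0 0)] on. A literal limit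
   from the left would be vacuous when A is entered by a jump. *)
Definition finite_time_attractive {R : realType} {n : nat} (A : set 'rV[R]_n)
    (H : hybrid_system R n) (X : set 'rV[R]_n) (T : 'rV[R]_n -> R) : Prop :=
  forall phi, max_solutions H X phi ->
    ((T (phi 0 0%N))%:E <=
       ereal_sup [set (p.1 + p.2%:R)%:E | p in arc_dom phi])%E /\
    (forall t j, arc_dom phi (t, j) -> T (phi 0 0%N) <= t + j%:R -> A (phi t j)).

Definition strongly_forward_pre_invariant {R : realType} {n : nat}
    (A : set 'rV[R]_n) (H : hybrid_system R n) : Prop :=
  forall phi, max_solutions H A phi ->
    forall t j, arc_dom phi (t, j) -> A (phi t j).

Definition uniform_semiglobal_persistent_flow_time {R : realType} {n : nat}
    (H : hybrid_system R n) (X : set 'rV[R]_n) : Prop :=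
  forall r : R, 0 <= r -> exists (tau : R) (N : nat), 0 < tau /\
    forall psi, is_solution H psi -> (X `&` eball r) (psi 0 0%N) ->
      forall t j, arc_dom psi (t, j) -> j%:R <= t / tau + N%:R.

Definition hybrid_basic_conditions {R : realType} {n : nat}
    (H : hybrid_system R n) : Prop :=
  [/\ closed (flow_set H) /\ closed (jump_set H),
      outer_semicontinuous_on (flow_map H) (flow_set H) /\
      locally_bounded_on (flow_map H) (flow_set H),
      flow_set H `<=` svdom (flow_map H) /\
      (forall x, flow_set H x -> convex_set (flow_map H x)),
      outer_semicontinuous_on (jump_map H) (jump_set H) /\
      locally_bounded_on (jump_map H) (jump_set H) &
      jump_set H `<=` svdom (jump_map H)].

Definition viability_conditions {R : realType} {n : nat}
    (H : hybrid_system R n) : Prop :=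
  [/\ forall x0, (flow_set H `\` jump_set H) x0 -> exists2 U, nbhs x0 U &
        forall x, (flow_set H `&` U) x ->
          (flow_map H x `&` tangent_cone (flow_set H) x) !=set0,
      [\/ compact (flow_set H),
          linear_growth_on (flow_map H) (flow_set H) |
          single_valued_locally_lipschitz_on (flow_map H) (flow_set H)] &
      forall x y, jump_set H x -> jump_map H x y ->
        (flow_set H `|` jump_set H) y].

Record loop_data (R : realType) (nx nu ny nc no nxh : nat) := LoopData {
  plant : 'rV[R]_nx * 'rV[R]_nu -> 'rV[R]_nx;
  output : 'rV[R]_nx -> 'rV[R]_ny;
  feedback : 'rV[R]_nc * 'rV[R]_nx -> 'rV[R]_nu;
  ctrl_flow_set : set ('rV[R]_nc * 'rV[R]_nx);
  ctrl_flow_map : 'rV[R]_nc * 'rV[R]_nx -> set 'rV[R]_nc;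
  ctrl_jump_set : set ('rV[R]_nc * 'rV[R]_nx);
  ctrl_jump_map : 'rV[R]_nc * 'rV[R]_nx -> set 'rV[R]_nc;
  dom_ctrl_jump_map : svdom ctrl_jump_map = ctrl_jump_set;
  obs_flow_set : set ('rV[R]_no * 'rV[R]_ny * 'rV[R]_nu);
  obs_flow_map : 'rV[R]_no * 'rV[R]_ny * 'rV[R]_nu -> set 'rV[R]_no;
  obs_output : 'rV[R]_no * 'rV[R]_ny -> 'rV[R]_nxh;
  syn_flow_set : set ('rV[R]_nx * 'rV[R]_nu * 'rV[R]_nxh);
  so_jump_set : set 'rV[R]_(nx + (nc + (nx + no)));
  so_jump_map : 'rV[R]_(nx + (nc + (nx + no))) -> set 'rV[R]_(nx + no);
  dom_so_jump_map : svdom so_jump_map = so_jump_set }.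

(* The closed-loop state (x, x_c, x_s, x_o) is the concatenated row vector
   [row_mx x (row_mx xc (row_mx xs xo))]; that of the nominal system is
   [row_mx x xc]. *)
Definition st_x {R : realType} {nx nc no : nat}
    (xi : 'rV[R]_(nx + (nc + (nx + no)))) : 'rV[R]_nx := lsubmx xi.

Definition st_xc {R : realType} {nx nc no : nat}
    (xi : 'rV[R]_(nx + (nc + (nx + no)))) : 'rV[R]_nc := lsubmx (rsubmx xi).

Definition st_xs {R : realType} {nx nc no : nat}
    (xi : 'rV[R]_(nx + (nc + (nx + no)))) : 'rV[R]_nx := lsubmx (rsubmx (rsubmx xi)).

Definition st_xo {R : realType} {nx nc no : nat}
    (xi : 'rV[R]_(nx + (nc + (nx + no)))) : 'rV[R]_no := rsubmx (rsubmx (rsubmx xi)).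

Definition nominal_system {R : realType} {nx nu ny nc no nxh : nat}
    (L : loop_data R nx nu ny nc no nxh) : hybrid_system R (nx + nc) :=
  let xof (z : 'rV[R]_(nx + nc)) : 'rV[R]_nx := lsubmx z in
  let xcof (z : 'rV[R]_(nx + nc)) : 'rV[R]_nc := rsubmx z in
  {| flow_set := [set z | ctrl_flow_set L (xcof z, xof z)];
     flow_map := fun z =>
       [set row_mx (plant L (xof z, feedback L (xcof z, xof z))) vc
          | vc in ctrl_flow_map L (xcof z, xof z)];
     jump_set := [set z | ctrl_jump_set L (xcof z, xof z)];
     jump_map := fun z =>
       [set row_mx (xof z) gc | gc in ctrl_jump_map L (xcof z, xof z)] |}.

Definition closed_loop {R : realType} {nx nu ny nc no nxh : nat}
    (L : loop_data R nx nu ny nc no nxh) :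
    hybrid_system R (nx + (nc + (nx + no))) :=
  let u xi := feedback L (st_xc xi, st_xs xi) in
  let y xi := output L (st_x xi) in
  {| flow_set := [set xi |
       [/\ ctrl_flow_set L (st_xc xi, st_xs xi),
           syn_flow_set L (st_xs xi, u xi, obs_output L (st_xo xi, y xi)) &
           obs_flow_set L (st_xo xi, y xi, u xi)]];
     flow_map := fun xi =>
       [set row_mx (plant L (st_x xi, u xi))
              (row_mx vc (row_mx (plant L (st_xs xi, u xi)) vo))
          | vc in ctrl_flow_map L (st_xc xi, st_xs xi)
          & vo in obs_flow_map L (st_xo xi, y xi, u xi)];
     jump_set := [set xi |
       ctrl_jump_set L (st_xc xi, st_xs xi) \/ so_jump_set L xi];
     jump_map := fun xi =>
       [set row_mx (st_x xi) (row_mx gc (row_mx (st_xs xi) (st_xo xi)))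
          | gc in ctrl_jump_map L (st_xc xi, st_xs xi)] `|`
       [set row_mx (st_x xi) (row_mx (st_xc xi) gso)
          | gso in so_jump_map L xi] |}.

Definition sv_lipschitz {R : realType} {m n : nat}
    (P : 'rV[R]_m -> set 'rV[R]_n) : Prop :=
  exists2 k : R, 0 <= k & forall x1 x2,
    (ereal_sup [set `| edist y (P x1) - edist y (P x2) |%:E | y in [set: 'rV[R]_n]]
      <= (k * enorm (x1 - x2))%:E)%E.

Definition sync_set {R : realType} {nx nc no : nat}
    (P : 'rV[R]_nx -> set 'rV[R]_no) : set 'rV[R]_(nx + (nc + (nx + no))) :=
  [set xi | st_x xi = st_xs xi /\ P (st_x xi) (st_xo xi)].

Definition target_set {R : realType} {nx nc no : nat}
    (P : 'rV[R]_nx -> set 'rV[R]_no) (A0 : set 'rV[R]_(nx + nc)) :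
    set 'rV[R]_(nx + (nc + (nx + no))) :=
  [set xi | A0 (row_mx (st_x xi) (st_xc xi)) /\ sync_set P xi].

(* Main.v *)
(** A solution starting in the enlargement of the target set is in the
    synchronization set from some hybrid time on. If its domain were unbounded
    while its flow time stays bounded, it would have infinitely many jumps, so it
    could be restarted at a jump taking place in the synchronization set. The
    restarted arc is again a solution (a jump point lies in the jump set, hence is
    an admissible initial point), and the persistent flow time bounds its number
    of jumps by an affine function of its bounded flow time: a contradiction. *)
Require Import Defs.
From mathcomp Require Import measurable_realfun.
Set Implicit Arguments.
Unset Strict Implicit.
Unset Printing Implicit Defensive.
Local Open Scope classical_set_scope.
Local Open Scope ring_scope.

(** Nonemptiness of [A] matters because [inf] of the empty set is 0. *)
Lemma edist_subset (R : realType) (n : nat) (A B : set 'rV[R]_n)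
    (v : 'rV[R]_n) : A !=set0 -> A `<=` B -> edist v B <= edist v A.
Proof.
move=> [a Aa] AB; apply: lb_le_inf; first by exists (enorm (a - v)), a.
move=> _ [w Aw <-]; apply: ge_inf; last by exists w => //; exact: AB.
by exists 0 => _ [z _ <-]; exact: sqrtr_ge0.
Qed.

Lemma shift_preimage_itvoc (R : numDomainType) (a b c : R) :
  shift c @^-1` `]a, b]%classic = `](a - c), (b - c)]%classic.
Proof.
by apply/seteqP; split=> x /=; rewrite !in_itv/= ltrBlDr lerBrDr.
Qed.

(** The pushforward agrees with Lebesgue measure on half-open intervals, and this determines it. *)
Lemma lebesgue_measure_shift (R : realType) (c : R) (A : set R) :
  measurable A ->
  pushforward lebesgue_measure (shift c : _ -> measurableTypeR R) A =
  lebesgue_measure A.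
Proof.
move=> mA; apply/esym/lebesgue_measure_unique => //=; first exact: measurable_funD.
move=> _ _ [[a b]] _ <-; rewrite /pushforward shift_preimage_itvoc/=.
by rewrite !lebesgue_measure_itv/= !lte_fin ltrD2r -!EFinD opprB subrKA.
Qed.

Lemma ae_shift (R : realType) (c : R) (Q Q' : R -> Prop) :
  (forall t, Q (t + c) -> Q' t) ->
  {ae lebesgue_measure, forall t : R, Q t} ->
  {ae lebesgue_measure, forall t : R, Q' t}.
Proof.
move=> QQ' [A [mA A0 QA]]; exists (shift c @^-1` A); split.
- rewrite -[X in measurable X]setTI.
  by apply: (measurable_funD (f := id) (g := cst c)) => //.
- by rewrite -A0 -(lebesgue_measure_shift c mA).
- by move=> t Q't; apply: QA => Qt; exact/Q't/QQ'.
Qed.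

Lemma is_derive_shift (R : realType) (V : normedModType R) (c t : R)
    (f : R -> V) (v : V) :
  is_derive (t + c) 1 f v -> is_derive t 1 (f \o shift c) v.
Proof.
have E : (fun h => h^-1 *: (((f \o shift c) \o shift t) (h *: 1) - (f \o shift c) t))
       = (fun h => h^-1 *: ((f \o shift (t + c)) (h *: 1) - f (t + c))).
  by apply/funext => h /=; rewrite addrA.
by move=> [df fv]; split; rewrite /derivable /derive E.
Qed.

Lemma interior_shift (R : realType) (c t : R) (S : set R) :
  (shift c @^-1` S)° t -> S° (t + c).
Proof. by move=> St; apply: (nbhsDl S t c).2. Qed.

Lemma absolutely_continuous_on_shift (R : realType) (n : nat) (c a b : R)
    (g : R -> 'rV[R]_n) :
  absolutely_continuous_on (a + c) (b + c) g ->
  absolutely_continuous_on a b (g \o shift c).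
Proof.
move=> gac e e0; have [d d0 gd] := gac e e0; exists d => // N l u lu tlu slu.
apply: (gd N (fun k => l k + c) (fun k => u k + c)).
- by move=> k; rewrite !lerD2r; exact: lu.
- move=> i j _ _ [x [/= xi xj]]; apply: tlu => //; exists (x - c).
  move: xi xj; rewrite !in_itv/= => /andP[? ?] /andP[? ?].
  by split; rewrite /= in_itv/= ltrBrDr ltrBlDr; apply/andP.
- under eq_bigr do rewrite opprD addrACA subrr addr0; exact: slu.
Qed.

Section hybrid_time_domain.
Context {R : realType}.
Variable E : set (R * nat).
Hypothesis htdE : hybrid_time_domain E.

(** Up to [(t, j)] the domain is a staircase with breakpoints [t_]; [t_ i.+1] both ends level [i]
    and starts level [i.+1]. *)
Lemma hybrid_time_domain_jump t i j : E (t, j) -> (i < j)%N ->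
  exists s, [/\ s <= t, E (s, i) & E (s, i.+1)].
Proof.
move=> Etj ij; have [_ /(_ _ _ Etj)[K [t_ [t0 tS EK]]]] := htdE.
have tmono : {homo t_ : m n / (m <= n)%N >-> m <= n}.
  by apply/nondecreasing_seqP.
have Etj' : (E `&` [set p | 0 <= p.1 <= t /\ (p.2 <= j)%N]) (t, j).
  by split=> //=; rewrite lexx (htdE.1 _ _ Etj).
move: (Etj'); rewrite EK => -[/= jK /andP[tjt _]].
have in_box k : (k <= i.+1)%N -> t_ k <= t_ i.+1 <= t_ k.+1 -> E (t_ i.+1, k).
  move=> ki tk; suff [] : (E `&` [set p | 0 <= p.1 <= t /\ (p.2 <= j)%N])
    (t_ i.+1, k) by [].
  by rewrite EK/=; split=> //; exact: leq_ltn_trans ki (leq_ltn_trans ij jK).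
exists (t_ i.+1); split; first exact: le_trans (tmono _ _ ij) tjt.
- by apply: in_box => //; rewrite tS lexx.
- by apply: in_box => //; rewrite tS lexx.
Qed.

(* The second hypothesis is needed: [0, 2] x {0} together with {1} x {1} is a
   hybrid time domain, as (2, 0) and (1, 1) are not comparable. *)
Lemma le_jump_time t0 j0 t j : E (t0, j0) -> E (t0, j0.+1) ->
  E (t, j) -> (j0 < j)%N -> t0 <= t.
Proof.
move=> E0 E1 Etj jj; have [s [st _ Es]] := hybrid_time_domain_jump Etj jj.
apply: le_trans st; rewrite leNgt; apply/negP => st0.
(* In the staircase up to [(t0, j0.+1)], level [j0] gives [t0 <= t_ j0.+1] and level [j0.+1] gives
   [t_ j0.+1 <= s], against [s < t0]. *)
have [_ /(_ _ _ E1)[K [t_ [_ _ EK]]]] := htdE.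
have : [set p : R * nat | (p.2 < K)%N /\ t_ p.2 <= p.1 <= t_ p.2.+1] (t0, j0).
  by rewrite -EK; split=> //=; rewrite lexx (htdE.1 _ _ E0).
have : [set p : R * nat | (p.2 < K)%N /\ t_ p.2 <= p.1 <= t_ p.2.+1] (s, j0.+1).
  by rewrite -EK; split=> //=; rewrite (ltW st0) (htdE.1 _ _ Es).
move=> [/= _ /andP[ts _]] [/= _ /andP[_ tt0]].
by move: (le_trans tt0 ts); rewrite leNgt st0.
Qed.

Lemma hybrid_time_domain_tail t0 j0 : E (t0, j0) ->
  hybrid_time_domain [set p : R * nat | 0 <= p.1 /\ E (p.1 + t0, (p.2 + j0)%N)].
Proof.
move=> E0; split=> [t j []//|T' J [/= T'0 ETJ]].
have [E_ge0 /(_ _ _ ETJ)[K [t_ [t00 tS EK]]]] := htdE.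
have tmono : {homo t_ : m n / (m <= n)%N >-> m <= n}.
  by apply/nondecreasing_seqP.
have t0_ge0 := E_ge0 _ _ E0.
have [/= j0K /andP[tj0 t0j]] :
    [set p : R * nat | (p.2 < K)%N /\ t_ p.2 <= p.1 <= t_ p.2.+1] (t0, j0).
  by rewrite -EK; split=> //=; rewrite t0_ge0 lerDr T'0 leq_addl.
(* The first [j0] levels are dropped and the breakpoints translated by [- t0]; the first one becomes
   0 because the restart may fall strictly inside level [j0]. *)
exists (K - j0)%N, (fun j => if j is j'.+1 then t_ (j' + j0).+1 - t0 else 0).
split=> // [[|j]|].
- by rewrite subr_ge0.
- by rewrite lerD2r.
apply/seteqP; split=> -[t j] /=.
  move=> [[t_ge0 Etj] [/andP[_ tT] jJ]].
  have [/= jK /andP[tjt ttj]] :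
      [set p : R * nat | (p.2 < K)%N /\ t_ p.2 <= p.1 <= t_ p.2.+1]
        (t + t0, (j + j0)%N).
    by rewrite -EK; split=> //=; rewrite addr_ge0// lerD2r tT leq_add2r.
  rewrite ltn_subRL addnC; split=> //; rewrite lerBrDr ttj andbT.
  by case: j tjt {Etj jJ jK ttj} => // j; rewrite addSn lerBlDr.
move=> [jK /andP[tjt ttj]].
have t_ge0 : 0 <= t.
  case: j tjt {ttj jK} => // j; apply: le_trans.
  by rewrite subr_ge0; apply: le_trans t0j (tmono _ _ _); rewrite ltnS leq_addl.
have [Etj [/= /andP[_ tT] jJ]] :
    (E `&` [set p | 0 <= p.1 <= T' + t0 /\ (p.2 <= J + j0)%N]) (t + t0, (j + j0)%N).
  rewrite EK/= addnC -ltn_subRL; split=> //; rewrite addnC -lerBrDr ttj andbT.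
  case: j tjt {ttj jK} => [|j] tjt; last by rewrite addSn -lerBlDr.
  by rewrite add0n (le_trans tj0)// lerDr.
by rewrite t_ge0 -(lerD2r t0) tT -(leq_add2r j0).
Qed.

End hybrid_time_domain.

(** Without the sign condition, the part of level [j0] before [t0] would appear at negative
    times. *)
Definition arc_tail (R : realType) (n : nat) (phi : hybrid_arc R n)
    (t0 : R) (j0 : nat) : hybrid_arc R n :=
  {| arc_dom := [set p | 0 <= p.1 /\ arc_dom phi (p.1 + t0, (p.2 + j0)%N)];
     arc_val := fun t j => phi (t + t0) (j + j0)%N |}.

(** Every clause survives translation except admissibility of the initial point, which is assumed: a
    jump may land outside both the closure of the flow set and the jump set. *)
Lemma is_solution_tail (R : realType) (n : nat) (H : hybrid_system R n)
    (phi : hybrid_arc R n) (t0 : R) (j0 : nat) :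
  is_solution H phi -> arc_dom phi (t0, j0) ->
  (closure (flow_set H) `|` jump_set H) (phi t0 j0) ->
  is_solution H (arc_tail phi t0 j0).
Proof.
move=> [htd _ ac fl jp] d0 start.
(* Only an inclusion, as times before [t0] are cut off; it is enough since taking interiors is
   monotone. *)
have sub j : flow_times (arc_tail phi t0 j0) j `<=`
    shift t0 @^-1` flow_times phi (j + j0)%N by move=> t [].
split.
- exact: hybrid_time_domain_tail.
- by rewrite /= !add0r add0n.
- move=> j a b ab abI.
  apply: (absolutely_continuous_on_shift (g := phi ^~ (j + j0)%N)).
  apply: (ac (j + j0)%N); first by rewrite lerD2r.
  move=> t /=; rewrite in_itv/= => /andP[at_ tb].
  rewrite -(subrK t0 t); apply: sub; apply: abI.
  by rewrite /= in_itv/= lerBrDr at_ lerBlDr.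
- move=> j [t /(interiorS (sub j)) tI].
  have [flC flF] := fl (j + j0)%N (ex_intro _ _ (interior_shift tI)).
  split=> [s /(interiorS (sub j)) sI|]; first exact/flC/interior_shift.
  apply: ae_shift flF => s Fs /sub/Fs[v dv Fv].
  by exists v => //; exact: is_derive_shift.
- by move=> t j [t_ge0 d1] [_ d2]; exact: jp.
Qed.

Lemma not_zeno_persistent_flow (R : realType) (n : nat) (H : hybrid_system R n)
    (A : set 'rV[R]_n) (phi : hybrid_arc R n) (T : R) :
  uniform_semiglobal_persistent_flow_time H A -> is_solution H phi ->
  (forall t j, arc_dom phi (t, j) -> T <= t + j%:R -> A (phi t j)) ->
  ~ is_zeno phi.
Proof.
move=> flowA sphi reach [cphi tbnd].
have [htd _ _ _ jp] := sphi.
have [B tB] : exists B : R, forall t j, arc_dom phi (t, j) -> t <= B.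
  move: (ereal_sup_ubound (S := [set p.1%:E | p in arc_dom phi])) tbnd.
  case: ereal_sup => [B||] ub // _.
    by exists B => t j d; rewrite -lee_fin; apply: ub; exists (t, j).
  by exists 0 => t j d; have := ub t%:E (ex_intro2 _ _ (t, j) d erefl).
(* Flow times are nonnegative, so every point at level [j0] or above is at or past hybrid time
   [T]. *)
have [j0 Tj0] : exists j0 : nat, T <= j0%:R.
  by exists (Num.bound `|T|); exact: le_trans (ler_norm _) (ltW (archi_boundP _)).
(* Time is bounded by [B], so completeness must come from the jump counter. *)
have late (m : nat) : exists t j, arc_dom phi (t, j) /\ (m < j)%N.
  have [t [j [d Btj]]] := cphi (B + m%:R); exists t, j; split=> //.
  rewrite -(ltr_nat R) -(ltrD2l B); apply: lt_le_trans Btj _.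
  by rewrite lerD2r (tB _ _ d).
have [t1 [j1 [d1 j01]]] := late j0.
have [t0 [_ d0 d0S]] := hybrid_time_domain_jump htd d1 j01.
have t0_ge0 := htd.1 _ _ d0.
have A0 : A (phi t0 j0).
  by apply: reach => //; apply: le_trans Tj0 _; rewrite lerDr.
have stail : is_solution H (arc_tail phi t0 j0).
  by apply: is_solution_tail => //; right; case: (jp _ _ d0 d0S).
have [tau [N [tau0 flow]]] := flowA (enorm (phi t0 j0)) (sqrtr_ge0 _).
(* Back to the original clock: [le_jump_time] makes [t - t0] nonnegative, so the shifted point
   belongs to the tail. *)
have {}flow t j : arc_dom phi (t, j) -> (j0 < j)%N ->
    (j - j0)%:R <= (t - t0) / tau + N%:R.
  move=> d j0j; apply: (flow _ stail).
    by split; rewrite /eball /= add0r add0n.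
  by split; rewrite /= ?subr_ge0 ?(le_jump_time htd d0 d0S d)// subrK subnK ?(ltnW j0j).
(* This level exceeds [j0] by more than [N + B / tau], while the flow bound allows at most
   [N + (t - t0) / tau] and [t - t0 <= B]. *)
have [t [j [d]]] := late (j0 + N + Num.bound (B / tau))%N.
rewrite -addnA -ltn_subRL => mj.
have j0j : (j0 < j)%N by rewrite -subn_gt0 (leq_ltn_trans _ mj).
move: (flow _ _ d j0j); rewrite leNgt => /negP; apply.
apply: (@le_lt_trans _ _ (N + Num.bound (B / tau))%:R); last by rewrite ltr_nat.
have B0 : 0 <= B := le_trans (htd.1 _ _ d) (tB _ _ d).
rewrite natrD addrC lerD2l.
apply: le_trans (ltW (archi_boundP (divr_ge0 B0 (ltW tau0)))).
by rewrite ler_pM2r ?invr_gt0// lerBlDr ler_wpDr// (tB _ _ d).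
Qed.

Theorem corollary1 (R : realType) (nx nu ny nc no nxh : nat)
  (L : loop_data R nx nu ny nc no nxh)
  (P : 'rV[R]_nx -> set 'rV[R]_no)
  (P_osc : outer_semicontinuous_on P setT)
  (P_bounded : locally_bounded_on P setT)
  (P_nonempty : forall x, P x !=set0)
  (P_closed : forall x, closed (P x))
  (P_lipschitz : sv_lipschitz P)
  (A0 : set 'rV[R]_(nx + nc))
  (A0_nonempty : A0 !=set0)
  (A0_compact : compact A0)
  (A0_gas : globally_asymptotically_stable A0 (nominal_system L))
  (H_basic : hybrid_basic_conditions (closed_loop L))
  (H_viable : viability_conditions (closed_loop L))
  (mu l : R) (T : 'rV[R]_(nx + (nc + (nx + no))) -> R)
  (mu_gt0 : 0 < mu)
  (l_gt : (ereal_sup [set (enorm xi)%:E | xi in enlarge (target_set P A0) mu]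
             < l%:E)%E)
  (T_ge0 : forall xi, 0 <= T xi)
  (As_fta : finite_time_attractive (sync_set P) (closed_loop L)
              (enlarge (sync_set P) mu `&` eball l) T)
  (T_bounded : (ereal_sup [set (T xi)%:E | xi in
                  enlarge (sync_set P) mu `&` eball l] < +oo)%E)
  (As_sfpi : strongly_forward_pre_invariant (sync_set P) (closed_loop L))
  (As_flow : uniform_semiglobal_persistent_flow_time (closed_loop L)
               (sync_set P)) :
  forall phi, max_solutions (closed_loop L) (enlarge (target_set P A0) mu) phi ->
    ~ is_zeno phi.
Proof.
move=> phi [[sphi mphi] phiA].
have A_nonempty : target_set P A0 !=set0.
  have [z A0z] := A0_nonempty; have [y Py] := P_nonempty (lsubmx z).
  exists (row_mx (lsubmx z) (row_mx (rsubmx z) (row_mx (lsubmx z) y))).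
  by rewrite /target_set /sync_set /= /st_x /st_xc /st_xs /st_xo
    !(row_mxKl, row_mxKr, hsubmxK).
apply: (not_zeno_persistent_flow As_flow sphi (T := T (phi 0 0%N))).
(* The initial point qualifies for [As_fta]: the target set lies in [sync_set P], so the distance to
   the latter is no larger, and [l] exceeds every norm on the enlarged target set. *)
have [|_] // := As_fta phi; split=> //; split.
  by apply: le_trans phiA; apply: edist_subset => // xi [].
rewrite /eball /= -lee_fin; apply/ltW; apply: le_lt_trans l_gt.
by apply: ereal_sup_ubound; exists (phi 0 0%N).
Qed.
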